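(* Let $a,b\in\mathbb{R}$ with $0<a<b$, let $p,q>1$ with $\frac1p+\frac1q=1$, $s\in(0,\frac1q)$ and $\lambda,\theta\in[0,1]$. Then $$\left|(1-\theta)A_\lambda(a^{s+1},b^{s+1})+\theta\,A_\lambda(b,a)^{s+1}-L_{s+1}(a,b)^{s+1}\right|$$ $$\le (b-a)\left(\frac{\theta^{p+1}+(1-\theta)^{p+1}}{p+1}\right)^{\frac1p}(s+1)^{1-\frac1q}\Bigl[\lambda^2\bigl(a^{sq}+A_\lambda(b,a)^{sq}\bigr)^{\frac1q}+(1-\lambda)^2\bigl(b^{sq}+A_\lambda(b,a)^{sq}\bigr)^{\frac1q}\Bigr].$$
   Context: For $\alpha\in[0,1]$ and $x,y\in\mathbb{R}$, the weighted arithmetic mean is $A_\alpha(x,y)=\alpha x+(1-\alpha)y$. For $r\in\mathbb{R}\setminus\{-1,0\}$ and $x,y>0$ with $x\ne y$, the $r$-logarithmic mean is $L_r(x,y)=\left(\frac{y^{r+1}-x^{r+1}}{(r+1)(y-x)}\right)^{1/r}$. *)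

(* Defs.v *)
From mathcomp Require Import all_boot all_order all_algebra.
From mathcomp Require Import all_classical all_reals all_analysis.

Set Implicit Arguments.
Unset Strict Implicit.
Unset Printing Implicit Defensive.

Import Order.TTheory GRing.Theory Num.Theory.

Local Open Scope ring_scope.

Definition wamean (R : realType) (alpha x y : R) : R :=
  alpha * x + (1 - alpha) * y.

(* The r-logarithmic mean; it is meaningful only for r different from -1 and 0
   and for distinct positive x and y. *)
Definition logmean (R : realType) (r x y : R) : R :=
  ((y `^ (r + 1) - x `^ (r + 1)) / ((r + 1) * (y - x))) `^ r^-1.

(* Main.v *)
(* With f y = y^(s+1) and C = A_lambda(b, a), the mean of f over [a, b] splits
   at C into the means over [a, C] and [C, b].  On each piece with end points
   x in {a, b} and C, integration by parts writes (x - C) times the weighted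
   trapezoid error as (x - C)^2 times the integral over [0, 1] of
   (t - theta) f'(t x + (1 - t) C).  Hölder's inequality, the subadditivity of
   y^(s q) for s q <= 1, and s + 1 <= s q + 1 bound this integral.  Integrals
   appear only through explicit primitives. *)
Require Import Defs.
From mathcomp Require Import all_boot all_order all_algebra.
From mathcomp Require Import all_classical all_reals all_analysis.
From mathcomp Require Import ring lra.

Import Order.TTheory GRing.Theory Num.Theory.
Import numFieldNormedType.Exports.

Local Open Scope ring_scope.

Lemma is_derive1_comp {R : realType} {f g : R -> R} {x df dg : R} :
  is_derive x 1 g dg -> is_derive (g x) 1 f df ->
  is_derive x 1 (fun t => f (g t)) (df * dg).
Proof.
move=> dgx dfx; have [gx gE] := dgx; have [fx fE] := dfx.
apply: DeriveDef.
  by apply/derivable1_diffP/differentiable_comp; apply/derivable1_diffP.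
by rewrite -derive1E derive1_comp// !derive1E gE fE.
Qed.

(** The absolute value gives an odd primitive valid on the whole line, 0 included. It serves for the
    [p]-th power of [|t - theta|], where [t - theta] may change sign, and for powers of [t] and
    [1 - t] up to the end points where they vanish. *)
Lemma is_derive_mul_norm_powR {R : realType} {r : R} (x : R) : 0 < r ->
  is_derive x 1 (fun y : R => y * `|y| `^ r) ((r + 1) * `|x| `^ r).
Proof.
move=> r0.
have pos (y : R) : 0 < y ->
    is_derive y 1 (fun z : R => z * `|z| `^ r) ((r + 1) * `|y| `^ r).
  move=> y0.
  have D : is_derive y 1 (fun z : R => z `^ (r + 1)) ((r + 1) * `|y| `^ r).
    rewrite gtr0_norm//.
    by have := is_derive1_powR (r + 1) y0; rewrite addrK.
  apply: near_eq_is_derive D.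
  near=> z.
  have z0 : 0 < z by near: z; exact: lt_nbhsr.
  rewrite gtr0_norm// powRD ?powRr1 ?ltW// 1?mulrC//.
  by rewrite gt_eqF// addr_gt0.
have [x0|x0|x0] := ltgtP x 0.
(* By oddness, the negative case is the positive one reflected twice. *)
- have y0 : 0 < - x by rewrite oppr_gt0.
  have := is_deriveN (is_derive1_comp (is_deriveNid x 1) (pos _ y0)).
  rewrite mulrN1 opprK normrN.
  by apply: near_eq_is_derive; near=> z; rewrite opprfctE/= normrN mulNr opprK.
- exact: pos.
- rewrite x0 normr0 powR0 ?gt_eqF// mulr0.
  (* At 0 the difference quotient is [|h|] to the power [r], which is below [e] once [|h|] is below
     [e] to the power [1/r]. *)
  have cvg0 : ((fun h : R => h^-1 *:
      (((fun y : R => y * `|y| `^ r) \o shift 0) (h *: 1)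
       - 0 * `|0 : R| `^ r)) @ 0^' --> (0 : R))%classic.
    apply/cvgrPdist_lt => e e0.
    near=> h.
    have h0 : h != 0 by near: h; exact: nbhs_dnbhs_neq.
    rewrite sub0r normrN /= mul0r subr0 addr0 /GRing.scale/= mulr1 mulKf// ger0_norm ?powR_ge0//.
    rewrite -[ltRHS](powRr1 (ltW e0)) -(mulVf (lt0r_neq0 r0)) powRrM.
    rewrite gt0_ltr_powR ?nnegrE ?powR_ge0//.
    by near: h; apply: dnbhs0_lt; rewrite powR_gt0.
  apply: DeriveDef; first by apply/cvg_ex; exists 0.
  exact/cvg_lim.
Unshelve. all: by end_near. Qed.

(** Both [G + F] and [G - F] have a nonnegative derivative, so neither decreases from [a] to [b], by
    the mean value theorem. This replaces the triangle inequality for integrals. *)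
Lemma le_norm_increment (R : realType) (F G f g : R -> R) (a b : R) : a <= b ->
  (forall t, t \in `[a, b] -> is_derive t 1 F (f t)) ->
  (forall t, t \in `[a, b] -> is_derive t 1 G (g t)) ->
  (forall t, t \in `[a, b] -> `|f t| <= g t) ->
  `|F b - F a| <= G b - G a.
Proof.
move=> ab dF dG fg.
have mono (H h : R -> R) : (forall t, t \in `[a, b] -> is_derive t 1 H (h t)) ->
    (forall t, t \in `[a, b] -> 0 <= h t) -> 0 <= H b - H a.
  move=> dH h0.
  have [|c cab ->] := MVT_segment ab (fun t tab => dH t (subset_itv_oo_cc tab)).
    by apply: derivable_within_continuous => t /dH[].
  by rewrite mulr_ge0 ?h0 ?subr_ge0.
have D : 0 <= (G + F) b - (G + F) a.
  apply: mono => t tab; first exact: is_deriveD (dG t tab) (dF t tab).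
  by have := fg t tab; rewrite ler_norml => /andP[]; lra.
have B : 0 <= (G - F) b - (G - F) a.
  apply: mono => t tab; first exact: is_deriveB (dG t tab) (dF t tab).
  by have := fg t tab; rewrite ler_norml => /andP[]; lra.
by move: D B; rewrite !fctE ler_norml => D B; apply/andP; split; lra.
Qed.

(* Hölder's inequality for a primitive: Young's inequality, applied after
   normalising the two increments to 1, bounds the derivative pointwise. *)
Lemma holder_increment (R : realType) (F U V f u v w : R -> R) (a b p q M : R) :
  a <= b -> 0 < p -> 0 < q -> p^-1 + q^-1 = 1 -> 0 <= M ->
  (forall t, t \in `[a, b] -> is_derive t 1 F (f t)) ->
  (forall t, t \in `[a, b] -> is_derive t 1 U (u t `^ p)) ->
  (forall t, t \in `[a, b] -> is_derive t 1 V (w t)) ->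
  (forall t, t \in `[a, b] -> 0 <= u t) ->
  (forall t, t \in `[a, b] -> 0 <= v t) ->
  (forall t, t \in `[a, b] -> v t `^ q <= w t) ->
  (forall t, t \in `[a, b] -> `|f t| <= M * (u t * v t)) ->
  0 < U b - U a -> 0 < V b - V a ->
  `|F b - F a| <= M * ((U b - U a) `^ p^-1 * (V b - V a) `^ q^-1).
Proof.
move=> ab p0 q0 pq M0 dF dU dV u0 v0 vw fuv.
set P := U b - U a; set S := V b - V a => P0 S0.
pose K := M * (P `^ p^-1 * S `^ q^-1).
have K0 : 0 <= K by rewrite !mulr_ge0 ?powR_ge0.
(* Since [1/p + 1/q = 1], the bound [K] is itself the increment of
   [K * (U / (P * p) + V / (S * q))], so comparing derivatives suffices. *)
have -> : M * (P `^ p^-1 * S `^ q^-1) =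
   (K * (U b / (P * p) + V b / (S * q))) - (K * (U a / (P * p) + V a / (S * q))).
  rewrite -mulrBr -[LHS]mulr1 -pq; congr (_ * _).
  transitivity (P / (P * p) + S / (S * q)); last by rewrite /P /S; ring.
  by field; rewrite !gt_eqF.
apply: (@le_norm_increment R F (fun t => K * (U t / (P * p) + V t / (S * q))) f
   (fun t => K * (u t `^ p / (P * p) + w t / (S * q)))) => // t tab.
  have := is_deriveZ K (is_deriveD (is_deriveZ (P * p)^-1 (dU t tab))
                                   (is_deriveZ (S * q)^-1 (dV t tab))).
  rewrite /GRing.scale/= ![_^-1 * _]mulrC; congr is_derive.
  by apply/funext => y; rewrite !fctE/= /GRing.scale/= ![_^-1 * _]mulrC.
apply: le_trans (fuv t tab) _.
have Pp : 0 < P `^ p^-1 by rewrite powR_gt0.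
have Sq : 0 < S `^ q^-1 by rewrite powR_gt0.
have := @conjugate_powR R (u t / P `^ p^-1) (v t / S `^ q^-1) p q.
rewrite !divr_ge0 ?(ltW Pp) ?(ltW Sq) ?u0 ?v0// => /(_ isT isT p0 q0 pq) young.
have inv_powR (x y r : R) : 0 <= x -> 0 < y -> 0 < r ->
    (x / y `^ r^-1) `^ r = x `^ r / y.
  move=> x0 y0 r0; rewrite powRM ?invr_ge0 ?powR_ge0// -powR_inv1 ?powR_ge0//.
  by rewrite -!powRrM mulN1r mulrN mulVf ?gt_eqF// powR_inv1// ltW.
rewrite !inv_powR ?u0 ?v0// in young.
have -> : M * (u t * v t) = K * (u t / P `^ p^-1 * (v t / S `^ q^-1)).
  by rewrite /K; field; rewrite !gt_eqF.
rewrite ler_wpM2l//; apply: le_trans young _.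
rewrite !invfM !mulrA lerD2l ler_wpM2r ?invr_ge0 ?(ltW q0)//.
by rewrite ler_wpM2r ?invr_ge0 ?(ltW S0)// vw.
Qed.

(** The shares of [u] and [v] in [u + v] lie in [0, 1] and add up to 1; as [r <= 1], each is at most
    its own [r]-th power. *)
Lemma powR_subadditive (R : realType) (r u v : R) : 0 < r -> r <= 1 ->
  0 <= u -> 0 <= v -> (u + v) `^ r <= u `^ r + v `^ r.
Proof.
move=> r0 r1 u0 v0.
have [->|uv0] := eqVneq (u + v) 0.
  by rewrite powR0 ?gt_eqF// addr_ge0 ?powR_ge0.
have uvp : 0 < u + v by rewrite lt_neqAle eq_sym uv0 addr_ge0.
have key w : 0 <= w -> w <= u + v -> w / (u + v) * (u + v) `^ r <= w `^ r.
  rewrite le_eqVlt => /predU1P[<- _|w0 wuv]; first by rewrite !mul0r powR_ge0.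
  have q1 : 0 < w / (u + v) <= 1 by rewrite divr_gt0//= ler_pdivrMr// mul1r.
  have -> : w `^ r = (w / (u + v)) `^ r * (u + v) `^ r.
    by rewrite -powRM ?divr_ge0 ?divfK ?ltW.
  by rewrite ler_wpM2r ?powR_ge0// ger1_powR.
apply: le_trans (lerD (key u u0 _) (key v v0 _)); rewrite ?lerDl ?lerDr//.
by rewrite -mulrDl -mulrDl divff// mul1r.
Qed.

(* Up to the factor x - c, the left-hand side is the modulus of the integral
   over [0, 1] of (t - theta) f'(t x + (1 - t) c), where f y = y^(s+1). *)
Lemma weighted_trapezoid_powR (R : realType) (x c p q s theta : R)
  (x0 : 0 < x) (c0 : 0 < c) (hp : 1 < p) (hq : 1 < q) (hpq : p^-1 + q^-1 = 1)
  (hs0 : 0 < s) (hsq : s < q^-1) (ht0 : 0 <= theta) (ht1 : theta <= 1) :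
  `| (x - c) * ((1 - theta) * x `^ (s + 1) + theta * c `^ (s + 1))
     - (x `^ (s + 2) - c `^ (s + 2)) / (s + 2) |
  <= (x - c) ^+ 2
     * (((theta `^ (p + 1) + (1 - theta) `^ (p + 1)) / (p + 1)) `^ p^-1
     * ((s + 1) `^ (1 - q^-1)
     * (x `^ (s * q) + c `^ (s * q)) `^ q^-1)).
Proof.
have p0 : 0 < p by lra.
have q0 : 0 < q by lra.
have sq0 : 0 < s * q by rewrite mulr_gt0.
have sq1 : s * q <= 1 by move: hsq; rewrite -[q^-1]mul1r ltr_pdivlMr// => /ltW.
have mul_powR (y r : R) : 0 <= y -> 0 < r -> y * `|y| `^ r = y `^ (r + 1).
  move=> y0 r0; rewrite ger0_norm// powRD ?powRr1 1?mulrC//.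
  by rewrite gt_eqF// addr_gt0.
pose g t := c + t * (x - c).
have dg (t : R) : is_derive t (1 : R) g (x - c).
  have := is_deriveD (is_derive_cst c t 1) (is_deriveZ (x - c) (is_derive_id t 1)).
  rewrite /GRing.scale/= add0r mulr1; congr is_derive.
  by apply/funext => y; rewrite !fctE/= /GRing.scale/= mulrC.
have gE t : g t = t * x + (1 - t) * c by rewrite /g; ring.
have g0 t : t \in `[0, 1] -> 0 < g t.
  rewrite in_itv/= gE le_eqVlt => /andP[/predU1P[<- _|t0 t1]].
    by rewrite mul0r subr0 mul1r add0r.
  by rewrite ltr_pwDl ?mulr_gt0// mulr_ge0 ?subr_ge0// ltW.
(* Integration by parts yields [F]: differentiating the product produces a term
   [(x - c) * g t ^ (s + 1)], which the last summand cancels. *)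
pose F t := (x - c) * ((t - theta) * g t `^ (s + 1)) - g t `^ (s + 2) / (s + 2).
pose U t := (t - theta) * `|t - theta| `^ p / (p + 1).
pose T t := t * `|t| `^ (s * q).
(* On [0, 1] the derivative of [V] is [(t x)^(s q) + ((1 - t) c)^(s q)], the subadditive majorant of
   [g t ^ (s q)]; unlike the latter, it makes the increment symmetric in [x] and [c]. *)
pose V t := (T t * x `^ (s * q) - T (1 - t) * c `^ (s * q)) / (s * q + 1).
pose P := (theta `^ (p + 1) + (1 - theta) `^ (p + 1)) / (p + 1).
pose S := (x `^ (s * q) + c `^ (s * q)) / (s * q + 1).
have dshift (t : R) : is_derive t (1 : R) (fun y : R => y - theta) 1.
  have := is_deriveB (is_derive_id t (1 : R)) (is_derive_cst theta t (1 : R)).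
  by rewrite subr0.
have dF (t : R) : t \in `[0, 1] ->
    is_derive t 1 F ((x - c) ^+ 2 * (s + 1) * ((t - theta) * g t `^ s)).
  move=> /g0 gt0.
  have d1 := is_derive1_comp (dg t) (is_derive1_powR (s + 1) gt0).
  have d2 := is_derive1_comp (dg t) (is_derive1_powR (s + 2) gt0).
  have := is_deriveB (is_deriveZ (x - c) (is_deriveM (dshift t) d1))
                     (is_deriveZ (s + 2)^-1 d2).
  congr is_derive.
    by apply/funext => y; rewrite /F !fctE/= /GRing.scale/=; ring.
  rewrite /GRing.scale/= addrK (_ : s + 2 - 1 = s + 1); last by ring.
  by field; rewrite gt_eqF//; lra.
have dU (t : R) : is_derive t 1 U (`|t - theta| `^ p).
  have := is_deriveZ (p + 1)^-1
    (is_derive1_comp (dshift t) (is_derive_mul_norm_powR (t - theta) p0)).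
  congr is_derive.
    by apply/funext => y; rewrite /U ?fctE/= /GRing.scale/=; ring.
  by rewrite /GRing.scale/=; field; rewrite gt_eqF//; lra.
have dT (t : R) : is_derive t 1 T ((s * q + 1) * `|t| `^ (s * q)).
  exact: is_derive_mul_norm_powR.
have dV (t : R) : is_derive t 1 V
    (`|t| `^ (s * q) * x `^ (s * q) + `|1 - t| `^ (s * q) * c `^ (s * q)).
  have d1 := is_deriveB (is_derive_cst (1 : R) t (1 : R)) (is_derive_id t (1 : R)).
  have := is_deriveZ (s * q + 1)^-1
    (is_deriveB (is_deriveZ (x `^ (s * q)) (dT t))
       (is_deriveZ (c `^ (s * q)) (is_derive1_comp d1 (dT (1 - t))))).
  congr is_derive.
    by apply/funext => y; rewrite /V !fctE/= /GRing.scale/=; ring.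
  by rewrite /GRing.scale/=; field; rewrite gt_eqF//; lra.
have UE : U 1 - U 0 = P.
  rewrite /U /P sub0r normrN mulNr !mul_powR ?subr_ge0//.
  by field; rewrite gt_eqF//; lra.
have VE : V 1 - V 0 = S.
  rewrite /V /S /T subr0 subrr normr0 normr1 powR1 powR0 ?gt_eqF//.
  by field; rewrite gt_eqF//; lra.
have FE : F 1 - F 0 =
    (x - c) * ((1 - theta) * x `^ (s + 1) + theta * c `^ (s + 1))
     - (x `^ (s + 2) - c `^ (s + 2)) / (s + 2).
  rewrite /F !gE subr0 subrr !mul1r !mul0r !add0r addr0.
  by field; rewrite gt_eqF//; lra.
have P0 : 0 < P.
  rewrite divr_gt0//; last lra.
  have [t0|t0] := ltP 0 theta; first by rewrite ltr_pwDl ?powR_gt0 ?powR_ge0.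
  by rewrite ltr_pwDr ?powR_ge0 ?powR_gt0//; lra.
have S0 : 0 < S by rewrite divr_gt0// addr_gt0// powR_gt0.
have M0 : 0 <= (x - c) ^+ 2 * (s + 1) by rewrite mulr_ge0 ?sqr_ge0//; lra.
have := @holder_increment R F U V _ (fun t => `|t - theta|) (fun t => g t `^ s)
  _ 0 1 p q _ ler01 p0 q0 hpq M0 dF (fun t _ => dU t) (fun t _ => dV t).
rewrite UE VE FE => H; apply: le_trans (H _ _ _ _ P0 S0) _.
- by move=> t _; rewrite normr_ge0.
- by move=> t _; rewrite powR_ge0.
- move=> t; rewrite in_itv/= => /andP[t0 t1]; rewrite -powRrM gE.
  rewrite !ger0_norm ?subr_ge0// -!powRM ?subr_ge0 ?(ltW x0) ?(ltW c0)//.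
  by apply: powR_subadditive; rewrite // mulr_ge0 ?subr_ge0// ltW.
- move=> t _; rewrite normrM ger0_norm// ler_wpM2l// normrM.
  by rewrite (ger0_norm (powR_ge0 _ _)).
rewrite -mulrA ler_wpM2l ?sqr_ge0// mulrCA ler_wpM2l ?powR_ge0//.
have s1 : 0 < s + 1 by lra.
(* The factor [s + 1] comes from the derivative of [y ^ (s + 1)]. The other one goes under the
   [q]-th root, where it remains to compare [1 / (s q + 1)] with [1 / (s + 1)]. *)
have -> : (s + 1) `^ (1 - q^-1) = (s + 1) * ((s + 1)^-1) `^ q^-1.
  rewrite powRB ?powRr1 ?(ltW s1)//; last by rewrite (lt0r_neq0 s1) implybT.
  rewrite -[(s + 1)^-1]powR_inv1 ?(ltW s1)// -powRrM mulN1r.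
  by rewrite powRN.
have T0 : 0 <= x `^ (s * q) + c `^ (s * q) by rewrite addr_ge0 ?powR_ge0.
have i0 : 0 <= (s + 1)^-1 by rewrite invr_ge0 ltW.
rewrite -mulrA ler_wpM2l ?(ltW s1)// -powRM//.
rewrite ge0_ler_powR ?nnegrE ?invr_ge0 ?(ltW q0) ?(ltW S0) ?(mulr_ge0 i0 T0)//.
rewrite [leRHS]mulrC ler_wpM2l// lef_pV2 ?posrE ?addr_gt0//.
by rewrite lerD2r ler_peMr// ltW.
Qed.

Theorem proposition2 (R : realType) (a b p q s lambda theta : R)
  (ha : 0 < a) (hab : a < b)
  (hp : 1 < p) (hq : 1 < q) (hpq : p^-1 + q^-1 = 1)
  (hs0 : 0 < s) (hsq : s < q^-1)
  (hl0 : 0 <= lambda) (hl1 : lambda <= 1)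
  (ht0 : 0 <= theta) (ht1 : theta <= 1) :
  `| (1 - theta) * wamean lambda (a `^ (s + 1)) (b `^ (s + 1))
     + theta * wamean lambda b a `^ (s + 1)
     - logmean (s + 1) a b `^ (s + 1) |
  <= (b - a)
     * ((theta `^ (p + 1) + (1 - theta) `^ (p + 1)) / (p + 1)) `^ p^-1
     * (s + 1) `^ (1 - q^-1)
     * (lambda ^+ 2 * (a `^ (s * q) + wamean lambda b a `^ (s * q)) `^ q^-1
        + (1 - lambda) ^+ 2
          * (b `^ (s * q) + wamean lambda b a `^ (s * q)) `^ q^-1).
Proof.
have b0 : 0 < b := lt_trans ha hab.
have ba : 0 < b - a by rewrite subr_gt0.
have c0 : 0 < wamean lambda b a.
  apply: (lt_le_trans ha); rewrite -subr_ge0.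
  have -> : wamean lambda b a - a = lambda * (b - a) by rewrite /wamean; ring.
  by rewrite mulr_ge0// ltW.
(* The outer power undoes the root because the quotient is nonnegative; what remains is the mean of
   [y ^ (s + 1)] over [a, b]. *)
have logE : logmean (s + 1) a b `^ (s + 1) =
    (b `^ (s + 2) - a `^ (s + 2)) / ((s + 2) * (b - a)).
  rewrite /logmean -powRrM mulVf ?gt_eqF//; last by lra.
  rewrite -addrA powRr1// divr_ge0//.
    by rewrite subr_ge0 ge0_ler_powR ?nnegrE//; lra.
  by rewrite mulr_ge0//; lra.
have Ha := weighted_trapezoid_powR R a (wamean lambda b a) p q s theta
  ha c0 hp hq hpq hs0 hsq ht0 ht1.
have Hb := weighted_trapezoid_powR R b (wamean lambda b a) p q s theta
  b0 c0 hp hq hpq hs0 hsq ht0 ht1.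
rewrite -(ler_pM2l ba) -{1}(gtr0_norm ba) -normrM.
set c := wamean lambda b a in Ha Hb c0 *.
(* Squaring these two differences gives the weights [lambda ^ 2] and [(1 - lambda) ^ 2], with a
   common factor [(b - a) ^ 2]. *)
have ca : a - c = - lambda * (b - a) by rewrite /c /wamean; ring.
have bc : b - c = (1 - lambda) * (b - a) by rewrite /c /wamean; ring.
(* In the difference of the two errors [c ^ (s + 2)] cancels, and the weights of [c ^ (s + 1)] add
   up to [theta * (b - a)]. *)
have := le_trans (ler_normB _ _) (lerD Hb Ha).
rewrite ca bc logE.
set A := a `^ (s + 2); set B := b `^ (s + 2); set C := c `^ (s + 2).
set P := _ `^ p^-1; set S := (s + 1) `^ _.
set Tb := (b `^ _ + _) `^ _; set Ta := (a `^ _ + _) `^ _.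
congr (_ <= _); first (congr `| _ |); rewrite /wamean; last ring.
by field; rewrite !gt_eqF//; lra.
Qed.
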